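(* Let $m = p_1^{k_1} p_2^{k_2} \cdots p_h^{k_h} \ge 2$ be the prime factor decomposition of $m$ (with $p_1,\dots,p_h$ distinct primes and $k_i \ge 1$), let $r \ge 1$, and let $F(X) = \sum_{i=1}^{r} \alpha_i X^{-i}$ be a finite formal power series with coefficients $\alpha_i \in \mathbb{Z}_m$. Suppose that there are finite formal power series $G_1,\dots,G_h$ such that $F(X)\, G_i(X) \equiv 1 \pmod{p_i^{k_i}}$ for $i=1,\dots,h$, and that for each $i = 1,\dots,h$ the index $j_i \in \{1,\dots,r\}$ is such that $\alpha_{j_i} = \dfrac{m}{p_i^{k_i}}$ and $\gcd(\alpha_{j_i}, p_i) = 1$. Let $f(x_1,\dots,x_r) = \sum_{i=1}^r \alpha_i x_i \pmod m$ be the local rule associated with $F$. Then the topological entropy of the cellular automaton $T_{f[1,r]}$ on $\mathbb{Z}_m^{\mathbb{Z}}$ generated by $f$ is $$\mathcal{H}(\mathbb{Z}_m^{\mathbb{Z}}, T_{f[1,r]}) = \sum_{i=1}^{h} j_i \log p_i^{k_i}.$$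
   Context: $\mathbb{Z}_m = \mathbb{Z}/m\mathbb{Z}$, and $\mathbb{Z}_m^{\mathbb{Z}}$ is the compact metrizable space of doubly infinite sequences over $\mathbb{Z}_m$ with the product topology. For integers $l \le r$ and a linear local rule $f(x_l,\dots,x_r) = \sum_{i=l}^r \lambda_i x_i \pmod m$ with $\lambda_i \in \mathbb{Z}_m$, the linear cellular automaton $T_{f[l,r]} : \mathbb{Z}_m^{\mathbb{Z}} \to \mathbb{Z}_m^{\mathbb{Z}}$ is the continuous map $(T_{f[l,r]}x)_n = \sum_{i=l}^r \lambda_i x_{n+i} \pmod m$, $n \in \mathbb{Z}$. A finite formal power series is a finite sum of integer (possibly negative) powers of $X$, i.e. a Laurent polynomial; the one associated with $f$ is $F(X) = \sum_{i=l}^r \lambda_i X^{-i}$. $\mathcal{H}(\mathbb{Z}_m^{\mathbb{Z}}, T)$ denotes the topological entropy of the continuous map $T$ (with the same logarithm, e.g. natural, in the definition of entropy and in the formula). *)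

(* Defs.v *)
From HB Require Import structures.
From mathcomp Require Export all_boot all_order all_algebra finmap.
From mathcomp Require Export all_classical all_reals all_analysis.

Set Implicit Arguments.
Unset Strict Implicit.
Unset Printing Implicit Defensive.

Import Order.TTheory GRing.Theory Num.Theory.
Export numFieldNormedType.Exports.

Local Open Scope classical_set_scope.
Local Open Scope ring_scope.

(* Topological entropy in the sense of Adler, Konheim and McAndrew. *)
Section TopologicalEntropy.
Context (R : realType) (X : topologicalType).
Implicit Types (U V : set (set X)) (T : X -> X).

Definition open_cover U : Prop :=
  (forall A, U A -> open A) /\ \bigcup_(A in U) A = [set: X].

Definition subcover_of_size U (n : nat) : Prop :=
  exists V, [/\ V `<=` U, \bigcup_(A in V) A = [set: X] & (V #= `I_n)%card].

(* It is +oo when U has no finite subcover, which cannot happen for an open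
   cover of a compact space. *)
Definition cover_number U : \bar R :=
  ereal_inf [set (n%:R)%:E | n in subcover_of_size U].

Definition cover_entropy U : \bar R := lne (cover_number U).

(* The join of U, T^-1 U, ..., T^-(n-1) U. *)
Definition iterated_join T U (n : nat) : set (set X) :=
  [set \bigcap_(i in `I_n) (iter i T @^-1` A i)
     | A in [set A : nat -> set X | forall i, U (A i)]].

(* For T continuous and X compact, the limit exists by subadditivity. The term
   of index 0 has no meaning, and is irrelevant. *)
Definition entropy_of_cover T U : \bar R :=
  limn (fun n => (n%:R^-1)%:E * cover_entropy (iterated_join T U n))%E.

Definition topological_entropy T : \bar R :=
  ereal_sup [set entropy_of_cover T U | U in open_cover].

End TopologicalEntropy.

Arguments topological_entropy R {X} T.

(* The integers l, l + 1, ..., r; only meaningful for l <= r. *)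
Definition int_range (l r : int) : seq int :=
  [seq l + i%:Z | i <- iota 0 `|r - l|%N.+1].

(* As everywhere with 'Z_m, this is the intended object for m >= 2 only. *)
Notation configuration m := {ptws int -> discrete_topology 'Z_m}.

Definition linear_ca (m : nat) (l r : int) (lambda : int -> 'Z_m)
    (x : configuration m) : configuration m :=
  fun n => \sum_(i <- int_range l r) lambda i * (x (n + i) : 'Z_m).

(* The value at d is the coefficient of X^d. *)
Notation laurent m := {fsfun int -> 'Z_m with 0}.

Section Laurent.
Context (m : nat).
Implicit Types F G : laurent m.

Definition laurent_one : laurent m := [fsfun d in [fset 0%Z]%fset => 1].

Definition laurent_mul F G : laurent m :=
  [fsfun d in [fset (a + b)%R | a in finsupp F, b in finsupp G]%fset
     => \sum_(a <- finsupp F) F a * G (d - a)].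

(* The coefficients are compared through their representatives in [0, m[, which
   is independent of that choice when q divides m. *)
Definition laurent_eqmod (q : nat) F G : Prop :=
  forall d : int, (F d : nat) = (G d : nat) %[mod q].

Definition laurent_of_rule (l r : int) (lambda : int -> 'Z_m) : laurent m :=
  [fsfun d in [fset (- i)%R | i in int_range l r]%fset => lambda (- d)].

End Laurent.

(* Main.v *)
Require Import Defs.
From mathcomp Require Import zify ring.
Import Order.TTheory GRing.Theory Num.Theory.

(* Let Y be the shift and P = \sum_i alpha_i Y^i, so that the automaton is the
   action T of P on sequences. Modulo p_i a unit Laurent polynomial is a
   monomial, hence P = alpha_{j_i} Y^{j_i} modulo p_i; since p_i^{k_i} divides m,
   raising to the m-th power gives P^m = u Y^{j_i m} modulo p_i^{k_i} with u
   invertible. Thus, modulo p_i^{k_i}, T^m is up to a unit the shift by j_i m,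
   and the windows seen along n steps of an orbit amount, up to a bounded number
   of coordinates, to the j_i n first coordinates of its origin. By the Chinese
   remainder theorem the number of such traces is \prod_i p_i^{k_i j_i n} up to
   a factor bounded in n, and these traces control the iterated joins of any
   open cover, by compactness. *)

Set Implicit Arguments.
Unset Strict Implicit.
Unset Printing Implicit Defensive.
Local Open Scope ring_scope.

(** * Congruences in Z/m *)

Lemma dvdn_natr_Zp m q n : (1 < m)%N -> (q %| m)%N ->
  (q %| (n%:R : 'Z_m))%N = (q %| n)%N.
Proof.
by move=> m1 qm; rewrite val_Zp_nat// {2}(divn_eq n m) dvdn_addr// dvdn_mull.
Qed.

(** Since [q] divides [m], divisibility of the representative is membership in the ideal generated
    by [q]; congruences can thus be carried through ring computations. *)
Lemma dvdn_ZpP {m q} (z : 'Z_m) : (1 < m)%N -> (q %| m)%N ->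
  reflect (exists y : 'Z_m, z = q%:R * y) (q %| z)%N.
Proof.
move=> m1 qm; apply: (iffP idP) => [/dvdnP[c zE]|[y ->]].
  by exists c%:R; rewrite -[z]natr_Zp zE mulnC natrM.
by rewrite -[y]natr_Zp -natrM dvdn_natr_Zp// dvdn_mulr.
Qed.

Lemma val_ZpM m (x y : 'Z_m) : (1 < m)%N -> (x * y : 'Z_m) = (x * y %% m)%N :> nat.
Proof. by move=> m1; rewrite -val_Zp_nat// natrM !natr_Zp. Qed.

Lemma Zp_Gauss_dvdr m q (u z : 'Z_m) : (1 < m)%N -> (q %| m)%N ->
  coprime q u -> (q %| (u * z)%R)%N = (q %| z)%N.
Proof.
move=> m1 qm cqu.
by rewrite val_ZpM// /dvdn modn_dvdm// -/(dvdn _ _) Gauss_dvdr.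
Qed.

Lemma coprime_ZpX m q (u : 'Z_m) n : (1 < m)%N -> (q %| m)%N ->
  coprime q u -> coprime q (u ^+ n)%R.
Proof.
move=> m1 qm cqu; elim: n => [|n IHn].
  by rewrite (val_Zp_nat m1 1) modn_small// coprimen1.
by rewrite exprS val_ZpM// -coprime_modr modn_dvdm// coprime_modr coprimeMr cqu.
Qed.

Section Congruence.
Context {A : comPzRingType}.
Implicit Types a b c : A.

Lemma congr_exp (n e : nat) a b c : a = b + n%:R * c ->
  exists d, a ^+ e = b ^+ e + n%:R * d.
Proof.
move=> ab; exists (c * \sum_(i < e) a ^+ (e.-1 - i) * b ^+ i).
by rewrite mulrA -[n%:R * c](addKr b) -ab [- b + a]addrC -subrXX addrC subrK.
Qed.

(** Each n-th power gains one factor [n]: in a'^n - b'^n = (a' - b') S, the cofactor S has [n]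
    terms, all congruent to b'^(n-1) modulo [n], so [n] divides S. *)
Lemma congr_expX (n s : nat) a b c : a = b + n%:R * c ->
  exists d, a ^+ (n ^ s) = b ^+ (n ^ s) + (n ^ s.+1)%:R * d.
Proof.
move=> ab; elim: s => [|s [d IHd]]; first by exists c; rewrite expn0 expn1.
rewrite expnSr !exprM; move: IHd.
set a' := a ^+ _; set b' := b ^+ _ => a'E.
have a'E1 : a' = b' + n%:R * ((n ^ s)%:R * d) by rewrite a'E mulrA -natrM -expnS.
have /choice[f fE] : forall i : nat, exists e,
    a' ^+ (n.-1 - i) * b' ^+ i = b' ^+ (n.-1 - i) * b' ^+ i + n%:R * e.
  move=> i; have [e ->] := congr_exp (n.-1 - i) a'E1.
  by exists (e * b' ^+ i); rewrite mulrDl mulrA.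
have sumE : \sum_(i < n) a' ^+ (n.-1 - i) * b' ^+ i
    = n%:R * (b' ^+ n.-1 + \sum_(i < n) f i).
  under eq_bigr do rewrite fE.
  rewrite big_split /= -mulr_sumr mulrDr; congr (_ + _).
  under eq_bigr => i _.
    rewrite -exprD subnK; last by case: (n) i => [[]|n' i]//=; rewrite -ltnS.
    over.
  by rewrite sumr_const card_ord mulr_natl.
exists (d * (b' ^+ n.-1 + \sum_(i < n) f i)).
apply/eqP; rewrite -subr_eq0 opprD addrA subr_eq0; apply/eqP.
rewrite subrXX sumE a'E addrC addKr [in RHS]expnSr natrM; ring.
Qed.

End Congruence.

(** * Linear rules as polynomials in the shift *)

(* Polynomials in the shift Y act on sequences; a rule is the polynomial
   [\sum_i lambda_i Y^i], so that Y plays the role of X^-1. *)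
Section ShiftAction.
Context {A : comNzRingType}.
Implicit Types (P Q : {poly A}) (x : int -> A).

Definition shift_act P x : int -> A :=
  fun n => \sum_(i < size P) P`_i * x (n + i%:Z).

Lemma shift_act_widen k P x n : (size P <= k)%N ->
  shift_act P x n = \sum_(i < k) P`_i * x (n + i%:Z).
Proof.
move=> Pk; rewrite /shift_act (big_ord_widen k (fun i => P`_i * x (n + i%:Z)))//.
rewrite big_mkcond/=; apply: eq_bigr => i _.
by case: ltnP => // /(nth_default 0) ->; rewrite mul0r.
Qed.

Lemma shift_actD P Q x n : shift_act (P + Q) x n = shift_act P x n + shift_act Q x n.
Proof.
pose k := maxn (size P) (size Q).
rewrite !(@shift_act_widen k) ?leq_maxl ?leq_maxr ?size_polyD//.
by rewrite -big_split/=; apply: eq_bigr => i _; rewrite coefD mulrDl.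
Qed.

Lemma shift_actZ c P x n : shift_act (c *: P) x n = c * shift_act P x n.
Proof.
rewrite (@shift_act_widen (size P)) ?size_scale_leq// /shift_act mulr_sumr.
by apply: eq_bigr => i _; rewrite coefZ mulrA.
Qed.

Lemma shift_actMX P x n : shift_act (P * 'X) x n = shift_act P x (n + 1).
Proof.
rewrite (@shift_act_widen (size P).+1); last first.
  by have [->|P0] := eqVneq P 0; rewrite ?mul0r ?size_poly0// size_mulX.
rewrite big_ord_recl coefMX mul0r add0r; apply: eq_bigr => i _.
by rewrite coefMX /= intS addrA.
Qed.

Lemma shift_actMXn P x n d : shift_act (P * 'X^d) x n = shift_act P x (n + d%:Z).
Proof.
elim: d n => [|d IHd] n; first by rewrite mulr1 addr0.
by rewrite exprSr mulrA shift_actMX IHd intS addrA.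
Qed.

(** This turns iterates of a rule into powers of its polynomial. Horner induction on [P] leaves only
    the factor ['X] and constants. *)
Lemma shift_actM P Q x : shift_act (P * Q) x = shift_act P (shift_act Q x).
Proof.
elim/poly_ind: P => [|P c IHP]; apply/funext => n.
  by rewrite mul0r /shift_act size_poly0 !big_ord0.
rewrite mulrDl shift_actD [RHS]shift_actD shift_actMX -IHP mulrAC shift_actMX.
rewrite mul_polyC shift_actZ; congr (_ + _).
rewrite (@shift_act_widen 1 c%:P) ?size_polyC_leq1// big_ord1 coefC eqxx.
by rewrite addr0.
Qed.

Lemma iter_shift_act P x t : iter t (shift_act P) x = shift_act (P ^+ t) x.
Proof.
elim: t => [|t IHt] /=; last by rewrite IHt exprS shift_actM.
by apply/funext => n; rewrite /shift_act size_poly1 big_ord1 coef1 mul1r addr0.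
Qed.

End ShiftAction.

(** * Laurent products, and rules modulo a prime factor of m *)

Section RuleMod.
Context (m : nat) (m_gt1 : (1 < m)%N).
Implicit Types F G : laurent m.

Lemma int_range1 r : (1 <= r)%N -> int_range 1 r%:Z = [seq i.+1%:Z | i <- iota 0 r].
Proof.
move=> r1; rewrite /int_range (_ : `|r%:Z - 1|%N.+1 = r); last lia.
by apply: eq_map => i; rewrite intS.
Qed.

Lemma laurent_mul_sum F G (s : seq int) d : uniq s ->
  (forall a, F a != 0 -> a \in s) ->
  laurent_mul F G d = \sum_(a <- s) F a * G (d - a).
Proof.
move=> s_uniq Fs.
have -> : laurent_mul F G d = \sum_(a <- finsupp F) F a * G (d - a).
  (* Off the declared domain the product takes its default value 0, and so does the sum: a nonzero G
     (d - a) would put d = a + (d - a) in the domain. *)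
  rewrite /laurent_mul fsfunE; case: ifPn => // dFG.
  rewrite big_seq big1// => a aF; have [->|Gda] := eqVneq (G (d - a)) 0.
    by rewrite mulr0.
  case/negP: dFG; apply/imfset2P; exists a => //=.
  by exists (d - a); rewrite /= ?mem_finsupp// addrC subrK.
have -> : \sum_(a <- s) F a * G (d - a) = \sum_(a <- s | F a != 0) F a * G (d - a).
  rewrite [RHS]big_mkcond; apply: eq_bigr => a _.
  by case: eqP => // ->; rewrite mul0r.
rewrite -[RHS]big_filter; apply: perm_big; apply: uniq_perm => [||a].
- exact: fset_uniq.
- exact: filter_uniq.
by rewrite mem_filter mem_finsupp; apply/idP/andP => [Fa|[]//]; split=> //; exact: Fs.
Qed.

Lemma laurent_mul_rule r (alpha : int -> 'Z_m) G d : (1 <= r)%N ->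
  laurent_mul (laurent_of_rule 1 r%:Z alpha) G d =
  \sum_(i < r) alpha i.+1%:Z * G (d + i.+1%:Z).
Proof.
move=> r1.
have mem_opp a : (a \in [fset (- i)%R | i in int_range 1 r%:Z]%fset) =
    (a \in [seq - i.+1%:Z | i <- iota 0 r]).
  apply/imfsetP/mapP => -[b /=].
    rewrite int_range1// => /mapP[i ir ->] ->; by exists i.
  by move=> br ->; exists b.+1%:Z => //=; rewrite int_range1// map_f.
rewrite (@laurent_mul_sum _ _ [seq - i.+1%:Z | i <- iota 0 r]).
- rewrite big_map -[in iota _ _](subn0 r) big_mkord; apply: eq_bigr => i _.
  rewrite /laurent_of_rule fsfunE mem_opp opprK (map_f (fun i : nat => - i.+1%:Z))//.
  by rewrite mem_iota /= add0n.
- by rewrite map_inj_uniq ?iota_uniq// => a b /oppr_inj[].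
by move=> a; rewrite /laurent_of_rule fsfunE mem_opp; case: ifP.
Qed.

(** The rule starts at index 1; the factor ['X] makes [alpha i] the coefficient of degree i. *)
Definition rule_poly r (alpha : int -> 'Z_m) : {poly 'Z_m} :=
  (\poly_(i < r) alpha i.+1%:Z) * 'X.

Lemma coef_rule_poly r alpha i : (rule_poly r alpha)`_i =
  if (0 < i <= r)%N then alpha i%:Z else 0.
Proof. by rewrite /rule_poly coefMX coef_poly; case: i. Qed.

Lemma linear_ca_shift_act r alpha (x : configuration m) : (1 <= r)%N ->
  linear_ca 1 r%:Z alpha x = shift_act (rule_poly r alpha) x.
Proof.
move=> r1; apply/funext => n; rewrite /linear_ca int_range1// big_map.
rewrite /rule_poly shift_actMX (@shift_act_widen _ r) ?size_poly//.
rewrite -[in iota _ _](subn0 r) big_mkord; apply: eq_bigr => i _.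
by rewrite coef_poly ltn_ord intS addrA.
Qed.

Context (p : nat) (p_prime : prime p) (pm : (p %| m)%N).

Let red (z : 'Z_m) : 'F_p := (z : nat)%:R.

Lemma red_natr n : red n%:R = n%:R.
Proof.
by rewrite /red -(Fp_nat_mod p_prime) val_Zp_nat// modn_dvdm// Fp_nat_mod.
Qed.

Lemma redD : {morph red : x y / x + y}.
Proof. by move=> x y; rewrite -[x]natr_Zp -[y]natr_Zp -natrD !red_natr natrD. Qed.

Lemma redM : {morph red : x y / x * y}.
Proof. by move=> x y; rewrite -[x]natr_Zp -[y]natr_Zp -natrM !red_natr natrM. Qed.

Lemma red_eq0 z : (red z == 0) = (p %| z)%N.
Proof. by rewrite /red -(dvdn_pcharf (pchar_Fp p_prime)). Qed.

(** Over the field F_p, clearing denominators in F G = 1 gives P Q = Y^s, so that P is a constant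
    times a power of Y; its nonzero coefficient at [j] identifies the power. *)
Lemma unit_rule_monomial r alpha (G : laurent m) j : (1 <= r)%N ->
  laurent_eqmod p (laurent_mul (laurent_of_rule 1 r%:Z alpha) G) (laurent_one m) ->
  (1 <= j <= r)%N -> ~~ (p %| alpha j%:Z)%N ->
  forall i, (1 <= i <= r)%N -> i != j -> (p %| alpha i%:Z)%N.
Proof.
move=> r1 FG jr pj i ir ij.
have [s Gs] : exists s : nat, forall d : int, (s < `|d|)%N -> G d = 0.
  exists (\sum_(a <- finsupp G) `|a|)%N => d sd; apply/eqP/negPn/negP.
  by rewrite -mem_finsupp => dG; move: sd; rewrite (big_fsetD1 d)//=; lia.
have red0 : red 0 = 0 by rewrite (red_natr 0).
pose P : {poly 'F_p} := \poly_(i < r.+1) red (rule_poly r alpha)`_i.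
(* The exponents of [G] lie in [-s, s]. As Y is X^-1, [Q] is Y^s G, of degree at most 2s in Y. *)
pose Q : {poly 'F_p} := \poly_(i < s.*2.+1) red (G (s%:Z - i%:Z)).
have coefP l : P`_l = red (rule_poly r alpha)`_l.
  by rewrite coef_poly; case: ltnP => // rl; rewrite coef_rule_poly (leqNgt l) rl/= andbF.
have coefQ l : Q`_l = red (G (s%:Z - l%:Z)).
  by rewrite coef_poly; case: ltnP => // sl; rewrite Gs//; lia.
have PQ : P * Q = 'X^s.
  apply/polyP => n; rewrite coefM coefXn.
  pose f l := (rule_poly r alpha)`_l * G (s%:Z - n%:Z + l%:Z).
  have -> : \sum_(l < n.+1) P`_l * Q`_(n - l) = red (\sum_(l < n.+1) f l).
    rewrite (big_morph red redD red0); apply: eq_bigr => l _.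
    rewrite redM coefP coefQ; congr (_ * red (G _)); have := ltn_ord l; lia.
  (* [f] vanishes beyond [r] because the rule stops there, and beyond [n] because the argument of
     [G] then exceeds [s]; both sums extend to n + r. *)
  have -> : \sum_(l < n.+1) f l = \sum_(l < r.+1) f l.
    have widen k : (k <= n + r)%N -> (forall l, (k < l <= n + r)%N -> f l = 0) ->
        \sum_(l < k.+1) f l = \sum_(l < (n + r).+1) f l.
      move=> kn f0; rewrite (big_ord_widen (n + r).+1)// big_mkcond/=.
      apply: eq_bigr => l _; rewrite ltnS; case: leqP => // kl.
      by rewrite f0// kl -ltnS ltn_ord.
    rewrite !widen ?leq_addl ?leq_addr// => l /andP[kl ln]; rewrite /f.
      by rewrite coef_rule_poly (leqNgt l) kl andbF mul0r.
    by rewrite Gs ?mulr0//; lia.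
  have -> : \sum_(l < r.+1) f l =
      laurent_mul (laurent_of_rule 1 r%:Z alpha) G (s%:Z - n%:Z).
    rewrite laurent_mul_rule// big_ord_recl /f coef_rule_poly mul0r add0r.
    by apply: eq_bigr => l _; rewrite coef_rule_poly /= ltn_ord.
  rewrite /red -(Fp_nat_mod p_prime) FG Fp_nat_mod// /laurent_one fsfunE inE.
  by rewrite subr_eq0 eqz_nat eq_sym -/(red _); case: eqP => _; rewrite ?red0 ?(red_natr 1).
have /dvdp_exp_XsubCP[e []] : P %| ('X - 0%:P) ^+ s by rewrite subr0 -PQ dvdp_mulr.
rewrite subr0 => es /eqpP[[c1 c2] /= /andP[c1n c2n] cP].
have Pl l : (P`_l == 0) = (l != e).
  have := congr1 (fun R : {poly 'F_p} => R`_l) cP; rewrite !coefZ coefXn => cPl.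
  rewrite -(mulrI_eq0 _ (mulfI c1n)) cPl mulf_eq0 (negbTE c2n) /=.
  by case: (l == e); rewrite ?eqxx ?oner_eq0.
have ej : j = e.
  by apply/eqP/negPn; rewrite -Pl coefP coef_rule_poly jr red_eq0.
by rewrite -red_eq0; move: (Pl i); rewrite coefP coef_rule_poly ir -ej ij => ->.
Qed.

End RuleMod.

(** * Orbits of a rule modulo a prime power *)

Section RuleDynamics.
Context (m : nat) (m_gt1 : (1 < m)%N) (p k : nat) (p_prime : prime p).
Context (k_gt0 : (0 < k)%N) (pkm : (p ^ k %| m)%N).
Context (r : nat) (r_gt0 : (1 <= r)%N) (alpha : int -> 'Z_m) (G : laurent m).
Hypothesis FG : laurent_eqmod (p ^ k)
  (laurent_mul (laurent_of_rule 1 r%:Z alpha) G) (laurent_one m).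
Context (j : nat) (jr : (1 <= j <= r)%N) (alpha_j : coprime (alpha j%:Z) p).

Local Notation P := (rule_poly r alpha).
Local Notation T := (shift_act P).

Let p_dvd_pk : (p %| p ^ k)%N.
Proof. by rewrite -[X in (X %| _)%N]expn1 dvdn_exp2l. Qed.

Let p_dvd_m : (p %| m)%N.
Proof. exact: dvdn_trans p_dvd_pk pkm. Qed.

Lemma rule_poly_monomial : exists Q : {poly 'Z_m},
  P = alpha j%:Z *: 'X^j + p%:R * Q.
Proof.
have FGp : laurent_eqmod p (laurent_mul (laurent_of_rule 1 r%:Z alpha) G) (laurent_one m).
  by move=> d; rewrite -(modn_dvdm _ p_dvd_pk) FG modn_dvdm.
have pj : ~~ (p %| alpha j%:Z)%N by rewrite -prime_coprime// coprime_sym.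
have div i : exists y : 'Z_m, i != j -> P`_i = p%:R * y.
  have [->|ij] := eqVneq i j; first by exists 0.
  rewrite coef_rule_poly; case: ifP => ir; last by exists 0; rewrite mulr0.
  have /(dvdn_ZpP _ m_gt1 p_dvd_m)[y yE] :=
    unit_rule_monomial m_gt1 p_prime p_dvd_m r_gt0 FGp jr pj ir ij.
  by exists y.
have [y yE] := choice div.
exists (\poly_(i < r.+1) if i == j then 0 else y i).
apply/polyP => i; rewrite coefD coefZ coefXn mulr_natl coefMn coef_poly.
have [->|ij] := eqVneq i j; first by rewrite mulr1 if_same mul0rn addr0 coef_rule_poly jr.
rewrite mulr0 add0r; case: ltnP => ir; first by rewrite yE// mulr_natl.
by rewrite coef_rule_poly (leqNgt i) ir andbF mul0rn.
Qed.

(** The p^k-th power improves the congruence modulo [p] to one modulo p^(k+1), more than enough. The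
    exponent [m] is a multiple of p^k that does not depend on the prime. *)
Lemma rule_poly_exp_monomial : exists u : 'Z_m, coprime (p ^ k) u /\
  forall s, exists Q, P ^+ (m * s) = u ^+ s *: 'X^(j * (m * s)) + (p ^ k)%:R * Q.
Proof.
exists (alpha j%:Z ^+ m); split.
  by rewrite coprimeXl// coprime_ZpX// coprime_sym.
move=> s; have [Q PE] := rule_poly_monomial.
have [D DE] := congr_expX k PE.
have {}DE : P ^+ (p ^ k) = (alpha j%:Z *: 'X^j) ^+ (p ^ k) + (p ^ k)%:R * (p%:R * D).
  by rewrite DE mulrA -natrM -expnSr.
case/dvdnP: (pkm) => c mE.
have [E EE] := congr_exp (c * s) DE; exists E.
have msE : (m * s = p ^ k * (c * s))%N by rewrite {1}mE mulnAC mulnC.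
by rewrite msE exprM EE -[in LHS]exprM -msE exprZn -exprM -exprM.
Qed.

(** For t = m s + t' with t' < m, modulo p^k the t-th iterate is a multiple of the shift by j m s <=
    j n followed by t' steps of the rule, which reach at most r m further to the right. *)
Lemma dvdn_iter_rule N n t (x : int -> 'Z_m) : (t <= n)%N ->
  (forall a, (- N%:Z <= a <= (N + r * m + j * n)%N%:Z)%R -> (p ^ k %| x a)%N) ->
  forall a, (`|a| <= N)%N -> (p ^ k %| iter t T x a)%N.
Proof.
move=> tn xdvd a aN; rewrite iter_shift_act (divn_eq t m).
have [u [cu uE]] := rule_poly_exp_monomial.
have [Q QE] := uE (t %/ m)%N.
rewrite exprD [(t %/ m * m)%N]mulnC QE mulrDl shift_actD mulrC -scalerAr -mulrA.
rewrite mulr_natl -scaler_nat !shift_actZ shift_actMXn.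
have sumdvd (y z : 'Z_m) : (p ^ k %| y)%N -> (p ^ k %| (y + (p ^ k)%:R * z)%R)%N.
  move=> /(dvdn_ZpP _ m_gt1 pkm)[w ->]; apply/dvdn_ZpP => //.
  by exists (w + z); rewrite mulrDr.
apply/sumdvd.
have muldvd (c y : 'Z_m) : (p ^ k %| y)%N -> (p ^ k %| (c * y)%R)%N.
  move=> /(dvdn_ZpP _ m_gt1 pkm)[w ->]; apply/dvdn_ZpP => //.
  by exists (c * w); rewrite mulrCA.
apply/muldvd.
have sz : (size (P ^+ (t %% m)) <= (r * (t %% m)).+1)%N.
  have szP : (size P <= r.+1)%N.
    by apply/leq_sizeP => i ri; rewrite coef_rule_poly (leqNgt i) ri andbF.
  apply: leq_trans (size_poly_exp_leq _ _) _; rewrite ltnS leq_mul2r.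
  by apply/orP; right; lia.
rewrite (shift_act_widen _ _ sz).
elim/big_ind: _ => [||[i ir] _ /=].
- by rewrite (val_Zp_nat m_gt1 0) mod0n.
- move=> y z ydvd /(dvdn_ZpP _ m_gt1 pkm)[w ->]; exact: sumdvd.
apply/muldvd; apply: xdvd.
have tE := divn_eq t m; have tm := ltn_pmod t (ltnW m_gt1).
have h1 : (j * (m * (t %/ m)) <= j * n)%N by rewrite leq_mul2l; apply/orP; right; lia.
have h2 : (r * (t %% m) <= r * m)%N by rewrite leq_mul2l (ltnW tm) orbT.
move: ir h1 h2; move: (j * (m * (t %/ m)))%N (r * (t %% m))%N.
move: (r * m)%N (j * n)%N => *; lia.
Qed.

(** Write b = j m s + a with a < j m <= r m. At time m s < n, coordinate [a] is u^s x(b) modulo p^k,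
    and u^s is invertible there. *)
Lemma dvdn_of_iter_rule n (x : int -> 'Z_m) :
  (forall t a, (t < n)%N -> (a < r * m)%N -> (p ^ k %| iter t T x a%:Z)%N) ->
  forall b : nat, (b < j * n)%N -> (p ^ k %| x b%:Z)%N.
Proof.
move=> xdvd b bn; have [u [cu uE]] := rule_poly_exp_monomial.
have jm0 : (0 < j * m)%N by rewrite muln_gt0; case/andP: jr => -> _; lia.
have bE := divn_eq b (j * m); have bm := ltn_pmod b jm0.
set s := (b %/ _)%N in bE; set a := (b %% _)%N in bE bm.
have [Q QE] := uE s.
have tn : (m * s < n)%N.
  case/andP: jr => j0 _; rewrite -(ltn_pmul2l j0); lia.
have am : (a < r * m)%N.
  by apply: leq_trans bm _; rewrite leq_mul2r; case/andP: jr => _ ->; rewrite orbT.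
have := xdvd _ _ tn am; rewrite iter_shift_act QE shift_actD.
rewrite mulr_natl -scaler_nat !shift_actZ -['X^_]mul1r shift_actMXn.
have -> : shift_act 1 x (a%:Z + (j * (m * s))%:Z) = x b.
  rewrite /shift_act size_poly1 big_ord1 coef1 mul1r addr0; congr x; lia.
move=> /(dvdn_ZpP _ m_gt1 pkm)[w wE].
rewrite -(Zp_Gauss_dvdr _ m_gt1 pkm (coprime_ZpX s m_gt1 pkm cu)).
apply/(dvdn_ZpP _ m_gt1 pkm); exists (w - shift_act Q x a).
by rewrite mulrBr -wE addrK.
Qed.

End RuleDynamics.

(** * Cover entropy *)

Local Open Scope classical_set_scope.
Local Open Scope ring_scope.

Lemma card_setT_finType (D : finType) : ([set: D] #= `I_#|D|)%card.
Proof.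
apply: card_eq_trans (card_esym card_II).
have -> : [set: D] = enum_val @` [set: 'I_#|D|].
  by apply/seteqP; split => // c _; exists (enum_rank c) => //; rewrite enum_rankK.
by apply: inj_card_eq => i i' _ _; exact: enum_val_inj.
Qed.

Section CoverNumber.
Context (R : realType) (X : topologicalType) (D : finType).
Implicit Types (V : set (set X)).

(** One member of [V] chosen for each attained value of [d] gives a subcover. *)
Lemma cover_number_le (d : X -> D) V :
  (forall x, exists2 B, V B & d @^-1` [set d x] `<=` B) ->
  (cover_number R V <= (#|D|%:R)%:E)%E.
Proof.
move=> dV.
have /choice[f fP] : forall c : D, exists B, forall x, d x = c ->
    V B /\ d @^-1` [set c] `<=` B.
  (* The empty set is a dummy choice at values that [d] does not take; only the image of [range d]
     is used. *)
  move=> c; have [[x <-]|nc] := pselect (exists x, d x = c).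
    by have [B VB dB] := dV x; exists B.
  by exists set0 => x xc; case: nc; exists x.
have : finite_set (f @` range d).
  by apply: finite_image; exact: sub_finite_set (subsetT _) (@finite_finset _ _).
case/finite_setP => n Vn.
have nD : (n <= #|D|)%N.
  rewrite -card_le_II -(card_le_eql Vn) -(card_le_eqr (card_setT_finType D)).
  exact: card_le_trans (card_image_le _ _) (subset_card_le (subsetT _)).
apply: (@le_trans _ _ (n%:R)%:E); last by rewrite lee_fin ler_nat.
apply: ereal_inf_lbound; exists n => //; exists (f @` range d); split => //.
  by move=> _ [_ [x _ <-] <-]; have [] := fP (d x) x erefl.
apply/seteqP; split => // x _; exists (f (d x)).
  by exists (d x).
by have [_] := fP (d x) x erefl; exact.
Qed.

(** No member contains two of the points [s c], so choosing a member through each point injects [D]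
    into any subcover. *)
Lemma cover_number_ge (s : D -> X) V :
  (forall B, V B -> forall c c', B (s c) -> B (s c') -> c = c') ->
  ((#|D|%:R)%:E <= cover_number R V)%E.
Proof.
move=> sV; apply: le_ereal_inf_tmp => _ [n [V' [V'V cov V'n]] <-].
rewrite lee_fin ler_nat.
have /choice[g gP] : forall c, exists B, V' B /\ B (s c).
  by move=> c; have : setT (s c) by []; rewrite -cov => -[B]; exists B.
have g_inj : injective g.
  move=> c c' gc; apply: (sV (g c)); first by apply/V'V; case: (gP c).
    by case: (gP c).
  by rewrite gc; case: (gP c').
rewrite -card_le_II -(card_le_eqr V'n) -(card_le_eql (card_setT_finType D)).
apply: card_le_trans (subset_card_le (_ : g @` setT `<=` V')); last first.
  by move=> _ [c _ <-]; case: (gP c).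
by rewrite (card_le_eqr (inj_card_eq _))// => c c' _ _; exact: g_inj.
Qed.

Lemma cover_number_ge0 V : (0 <= cover_number R V)%E.
Proof. by apply: le_ereal_inf_tmp => _ [n _ <-]; rewrite lee_fin. Qed.

Lemma cover_entropy_le (d : X -> D) V : (0 < #|D|)%N ->
  (forall x, exists2 B, V B & d @^-1` [set d x] `<=` B) ->
  (cover_entropy R V <= (ln #|D|%:R)%:E)%E.
Proof.
move=> D0 /cover_number_le le_D; rewrite -lne_EFin ?ltr0n//.
by rewrite /cover_entropy lee_lne ?in_itv/= ?leey ?andbT ?cover_number_ge0 ?lee_fin ?ler0n.
Qed.

Lemma cover_entropy_ge (s : D -> X) V : (0 < #|D|)%N ->
  (forall B, V B -> forall c c', B (s c) -> B (s c') -> c = c') ->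
  ((ln #|D|%:R)%:E <= cover_entropy R V)%E.
Proof.
move=> D0 /cover_number_ge ge_D; rewrite -lne_EFin ?ltr0n//.
by rewrite /cover_entropy lee_lne ?in_itv/= ?leey ?andbT ?cover_number_ge0 ?lee_fin ?ler0n.
Qed.

End CoverNumber.

(** * Entropy from linear bounds on the iterated joins *)

Section EntropyLimit.
Context (R : realType) (X : topologicalType) (T : X -> X).
Implicit Types (U : set (set X)).

Lemma cvg_addMn (h0 C : R) :
  ((h0 + n%:R^-1 * C)%:E @[n --> \oo] --> h0%:E)%classic.
Proof.
apply: cvg_EFin; first by near=> n.
rewrite -[X in _ --> X]addr0 -[X in _ --> _ + X](mul0r C).
apply: cvgD; first exact: cvg_cst.
apply: cvgM; last exact: cvg_cst.
(* The harmonic sequence is 1/(n+1), hence the shift of index. *)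
rewrite -cvg_shiftS; exact: cvg_harmonic.
Unshelve. all: by end_near. Qed.

Lemma mean_le (n : nat) (h0 C : R) (e : \bar R) : (0 < n)%N ->
  (e <= (n%:R * h0 + C)%:E)%E ->
  ((n%:R^-1)%:E * e <= (h0 + n%:R^-1 * C)%:E)%E.
Proof.
move=> n0 le_e; have n0R : 0 < n%:R :> R by rewrite ltr0n.
apply: le_trans (lee_wpmul2l _ le_e) _; first by rewrite lee_fin invr_ge0 ltW.
by rewrite -EFinM lee_fin mulrDr mulKf ?gt_eqF.
Qed.

(** The constant [C] may depend on the cover but not on [n], so it disappears after division by [n];
    the supremum is attained at the cover of the lower bound. *)
Lemma topological_entropy_eq (h0 : R) : 0 <= h0 ->
  (forall U, open_cover U -> exists C, forall n, (0 < n)%N ->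
    (cover_entropy R (iterated_join T U n) <= (n%:R * h0 + C)%:E)%E) ->
  (exists2 U, open_cover U & forall n, (0 < n)%N ->
    ((n%:R * h0)%:E <= cover_entropy R (iterated_join T U n))%E) ->
  topological_entropy R T = h0%:E.
Proof.
move=> h0_ge0 le_h0 [U Ucov ge_h0].
have mean_le_near V : open_cover V -> exists C, \forall n \near \oo,
    ((n%:R^-1)%:E * cover_entropy R (iterated_join T V n) <= (h0 + n%:R^-1 * C)%:E)%E.
  move=> /le_h0[C CP]; exists C; near=> n.
  have n0 : (0 < n)%N by near: n; exists 1%N.
  exact: mean_le n0 (CP n n0).
apply/eqP; rewrite eq_le; apply/andP; split.
  apply: ge_ereal_sup => _ [V Vcov <-]; rewrite /entropy_of_cover.
  have [C CP] := mean_le_near V Vcov.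
  (* Where the sequence diverges, [limn] is the junk value 0, still at most [h0]. *)
  have [cv|/dvgP->] := pselect (cvgn (fun n =>
    ((n%:R^-1)%:E * cover_entropy R (iterated_join T V n))%E)); last first.
    by rewrite lee_fin.
  rewrite -(cvg_lim _ (@cvg_addMn h0 C))//; apply: lee_lim => //.
  by apply/cvg_ex; exists h0%:E; exact: cvg_addMn.
suff -> : h0%:E = entropy_of_cover R T U by apply: ereal_sup_ubound; exists U.
have [C CP] := mean_le_near U Ucov.
apply/esym/cvg_lim => //.
apply: (@squeeze_cvge _ _ _ _ (cst h0%:E) _ (fun n => (h0 + n%:R^-1 * C)%:E)).
- near=> n; apply/andP; split; last by near: n.
  have n0 : (0 < n)%N by near: n; exists 1%N.
  have n0R : 0 < n%:R :> R by rewrite ltr0n.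
  apply: le_trans (lee_wpmul2l _ (ge_h0 n n0)); last by rewrite lee_fin invr_ge0 ltW.
  by rewrite -EFinM lee_fin mulKf ?gt_eqF.
- exact: cvg_cst.
- exact: cvg_addMn.
Unshelve. all: by end_near. Qed.

End EntropyLimit.

(** * Cylinders and compactness of the configuration space *)

Section Cylinders.
Context (m : nat).
Implicit Types (x y : configuration m) (N : nat).

Definition cylinder x N : set (configuration m) :=
  [set y | forall a : int, (`|a| <= N)%N -> y a = x a].

Lemma nbhs_cylinder x N : nbhs x (cylinder x N).
Proof.
have xa (a : int) : nbhs x [set y : configuration m | y a = x a].
  exact: (@proj_continuous int (fun=> discrete_topology 'Z_m) a x
    [set (x a)] (discrete_set1 _)).
have := @filter_forall _ _ (fun (i : 'I_(N.*2.+1)) (y : configuration m) =>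
  y (i%:Z - N%:Z) = x (i%:Z - N%:Z)) (nbhs x) (nbhs_filter x) (fun i => xa _).
apply: filterS => y yx a aN.
have aE : (`|(a + N%:Z)%R|%N < N.*2.+1)%N by lia.
have := yx (Ordinal aE); rewrite /= (_ : _ - _ = a)//; lia.
Qed.

(** Otherwise each cylinder around [x] has a point outside [A]; these points converge to [x], since
    coordinate a is constant from rank |a| on. *)
Lemma cylinder_sub x A : nbhs x A -> exists N, cylinder x N `<=` A.
Proof.
move=> xA; apply: contrapT => noN.
have /choice[y yP] : forall N, exists y, cylinder x N y /\ ~ A y.
  move=> N; apply: contrapT => noy; apply: noN; exists N => y yN.
  by apply: contrapT => nAy; apply: noy; exists y.
have : y @ \oo --> x.
  apply/cvg_sup => a U [V] [[W] oW <-] /= WxA WU.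
  apply: (filterS WU); rewrite nbhs_simpl /=; exists `|a|%N => // N /= aN.
  by have [-> //] := yP N.
move=> /(_ _ xA); rewrite nbhs_simpl => -[N _ /(_ N)/= AN].
by have [_] := yP N; apply; apply: AN.
Qed.

Lemma compact_configuration : compact [set: configuration m].
Proof.
have := @tychonoff int (fun _ => discrete_topology 'Z_m) (fun _ => setT)
  (fun _ => @finite_compact (discrete_topology 'Z_m) _ (@finite_finset ('Z_m : finType) _)).
by congr compact; apply/seteqP; split.
Qed.

Lemma open_cylinder x N : open (cylinder x N).
Proof.
rewrite openE => y yx; rewrite /interior.
suff -> : cylinder x N = cylinder y N by exact: nbhs_cylinder.
by apply/seteqP; split=> z zN a aN; rewrite zN ?yx.
Qed.

Lemma open_cover_cylinders N : open_cover [set cylinder x N | x in setT].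
Proof.
split=> [_ [x _ <-]|]; first exact: open_cylinder.
by apply/seteqP; split => // x _; exists (cylinder x N) => //; exists x.
Qed.

(** This is the Lebesgue number lemma, with cylinders as balls. *)
Lemma open_cover_cylinder_sub U : open_cover U -> exists N,
  forall x : configuration m, exists2 A, U A & cylinder x N `<=` A.
Proof.
case=> Uopen Ucov.
have /compact_near_coveringP/(_ nat \oo
  (fun N x => exists2 A, U A & cylinder x N `<=` A)) := compact_configuration.
case=> [x _|N _ NP]; last by exists N => x; exact: (NP N (leqnn N) x I).
have : setT x by []; rewrite -Ucov => -[A UA Ax].
have [N NA] := @cylinder_sub x A (open_nbhs_nbhs (conj (Uopen _ UA) Ax)).
exists (cylinder x N, [set k | (N <= k)%N]) => /=.
  by split; [exact: nbhs_cylinder|exists N].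
move=> [y k] [/= yx Nk]; exists A => // z zy; apply: NA => a aN.
by rewrite zy ?yx// (leq_trans aN).
Qed.

End Cylinders.

(** * The entropy of a linear rule *)

Lemma dvdn_Zp_sub m q (x y : 'Z_m) : (1 < m)%N -> (q %| m)%N ->
  (q %| (x - y)%R)%N = ((x : nat) == y %[mod q])%N.
Proof.
move=> m1 qm; have -> : (x : nat) = ((x - y)%R + y)%N %[mod q].
  by rewrite -[in RHS](modn_dvdm _ qm) -(val_Zp_nat m1) natrD !natr_Zp subrK.
by rewrite -[X in _ = (_ == X %[mod q])]add0n eqn_modDr mod0n.
Qed.

(** By linearity, comparing two orbits modulo q is a divisibility question about the orbit of the
    difference. *)
Lemma iter_shift_actB (A : comNzRingType) (P : {poly A}) (x y : int -> A) t n :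
  iter t (shift_act P) (fun a => x a - y a) n =
  iter t (shift_act P) x n - iter t (shift_act P) y n.
Proof.
rewrite !iter_shift_act /shift_act -sumrB.
by apply: eq_bigr => i _; rewrite mulrBr.
Qed.

Lemma dvdn_prod_coprime (I : finType) (q : I -> nat) (z : nat) :
  (forall i l, i != l -> coprime (q i) (q l)) -> (forall i, (q i %| z)%N) ->
  (\prod_i q i %| z)%N.
Proof.
move=> q_co qz; have := index_enum_uniq I.
elim: index_enum => [|i s IHs] /=; first by rewrite big_nil dvd1n.
case/andP=> is_ /IHs sz; rewrite big_cons Gauss_dvd ?qz//.
rewrite coprime_sym; rewrite big_seq; apply: (big_ind (coprime^~ (q i))) => [|a b|l ls].
- exact: coprime1n.
- by rewrite coprimeMl => -> ->.
- by apply: q_co; apply: contraNneq is_ => <-.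
Qed.

Lemma ln_prod_expn (R : realType) (I : finType) (q e : I -> nat) :
  (forall i, (0 < q i)%N) ->
  ln ((\prod_i q i ^ e i)%N%:R : R) = \sum_i (e i)%:R * ln (q i)%:R.
Proof.
move=> q0; suff [] : (0 < \prod_i q i ^ e i)%N /\
    ln ((\prod_i q i ^ e i)%N%:R : R) = \sum_i (e i)%:R * ln (q i)%:R by [].
apply: (big_ind2 (fun (a : nat) (b : R) => (0 < a)%N /\ ln a%:R = b)).
- by split=> //; rewrite ln1.
- move=> a _ b _ [a0 <-] [b0 <-]; split; first by rewrite muln_gt0 a0.
  by rewrite natrM lnM// posrE ltr0n.
- move=> i _; split; first by rewrite expn_gt0 q0.
  by rewrite natrX lnXn ?ltr0n// mulr_natl.
Qed.

(** These families encode traces: for each prime factor, a word of [e i] residues modulo [q i]. *)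
Lemma card_dffun_ord (I : finType) (q e : I -> nat) :
  #|{dffun forall i : I, {ffun 'I_(e i) -> 'I_(q i)}}| = (\prod_i q i ^ e i)%N.
Proof.
rewrite card_dep_ffun foldrE big_image /=; apply: eq_bigr => i _.
by rewrite card_ffun !card_ord.
Qed.

Theorem theorem3p5 (R : realType) (m h : nat) (p k : 'I_h -> nat)
    (hm : (2 <= m)%N)
    (p_prime : forall i, prime (p i)) (p_inj : injective p)
    (k_gt0 : forall i, (1 <= k i)%N)
    (m_fact : m = (\prod_(i < h) p i ^ k i)%N)
    (r : nat) (hr : (1 <= r)%N) (alpha : int -> 'Z_m)
    (G : 'I_h -> laurent m)
    (FG : forall i, laurent_eqmod (p i ^ k i)
            (laurent_mul (laurent_of_rule 1 r%:Z alpha) (G i)) (laurent_one m))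
    (j : 'I_h -> nat)
    (j_range : forall i, (1 <= j i <= r)%N)
    (alpha_j : forall i, alpha (j i)%:Z = (m %/ p i ^ k i)%:R)
    (alpha_j_coprime : forall i, gcdn (alpha (j i)%:Z) (p i) = 1%N) :
  topological_entropy R (linear_ca 1 r%:Z alpha) =
    (\sum_(i < h) (j i)%:R * ln ((p i ^ k i)%:R))%:E.
Proof.
pose q i := (p i ^ k i)%N.
have q_gt0 i : (0 < q i)%N by rewrite expn_gt0 prime_gt0.
have q_coprime i l : i != l -> coprime (q i) (q l).
  move=> il; rewrite coprimeXl// coprimeXr// prime_coprime// dvdn_prime2//.
  by apply: contraNneq il => /p_inj ->.
have alpha_j_coprime' i : coprime (alpha (j i)%:Z) (p i) by exact/eqP.
have qm i : (q i %| m)%N by rewrite m_fact (bigD1 i)//= dvdn_mulr.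
(* Injectivity in the Chinese remainder theorem. *)
have q_inj (z : 'Z_m) : (forall i, (q i %| z)%N) -> z = 0.
  move=> qz; have /(dvdn_prod_coprime q_coprime) : forall i, (q i %| z)%N by [].
  rewrite -m_fact; have [->//|z0] := eqVneq z 0.
  by rewrite gtnNdvd ?lt0n// -[X in (_ < X)%N](Zp_cast hm) ltn_ord.
have -> : linear_ca 1 r%:Z alpha = shift_act (rule_poly r alpha) :> (configuration m -> configuration m).
  by apply/funext => x; exact: linear_ca_shift_act.
set T : configuration m -> configuration m := shift_act _.
apply: topological_entropy_eq => [|U /open_cover_cylinder_sub[N NP]|].
- by apply: sumr_ge0 => i _; rewrite mulr_ge0// ln_ge0// ler1n; exact: q_gt0.
(* The window from -N to N + r m + j_i n has j_i n + C coordinates. As the [q i] multiply to [m],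
   the excess C contributes C ln m in all. *)
- pose C := (N.*2.+1 + r * m)%N.
  exists (C%:R * ln m%:R) => n n0.
  pose e i := (j i * n + C)%N.
  pose d (x : configuration m) : {dffun forall i, {ffun 'I_(e i) -> 'I_(q i)}} :=
    [ffun i => [ffun b => Ordinal (ltn_pmod (x ((nat_of_ord b)%:Z - N%:Z) : 'Z_m) (q_gt0 i))]].
  have dP x y : d y = d x -> forall i a, (- N%:Z <= a <= (N + r * m + j i * n)%N%:Z)%R ->
      (q i %| (y a - x a : 'Z_m)%R)%N.
    move=> dyx i a aN; have be : (`|(a + N%:Z)%R|%N < e i)%N by rewrite /e /C; lia.
    have := congr1 (fun c : {dffun forall i, {ffun 'I_(e i) -> 'I_(q i)}} =>
      c i (Ordinal be) : nat) dyx.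
    rewrite !ffunE /= (_ : _ - _ = a) => [/eqP yx|]; last lia.
    by rewrite dvdn_Zp_sub.
  have card_gt0 : (0 < #|{dffun forall i, {ffun 'I_(e i) -> 'I_(q i)}}|)%N.
    by rewrite card_dffun_ord; apply: prodn_gt0 => i; rewrite expn_gt0 q_gt0.
  apply: le_trans (cover_entropy_le (d := d) _ card_gt0 _) _ => [x|].
    have /choice[A AP] : forall t, exists A, U A /\ cylinder (iter t T x) N `<=` A.
      by move=> t; have [A] := NP (iter t T x); exists A.
    exists (\bigcap_(t in `I_n) (iter t T @^-1` A t)).
      by exists A => // t; case: (AP t).
    (* If [y] has the code of [x], their orbits agree on [-N, N] modulo every [q i] up to time [n],
       hence agree there in Z_m. *)
    move=> y /= dyx t tn; apply: (AP t).2 => a aN.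
    apply: subr0_eq; apply: q_inj => i; rewrite -iter_shift_actB.
    exact: (dvdn_iter_rule hm (p_prime i) (k_gt0 i) (qm i) hr (@FG i) (j_range i) (alpha_j_coprime' i) (ltnW tn) (dP x y dyx i)).
  have lnm : ln (m%:R : R) = \sum_i ln (q i)%:R.
    rewrite m_fact (eq_bigr (fun i => q i ^ 1)%N) => [|i _]; last by rewrite expn1.
    by rewrite ln_prod_expn//; apply: eq_bigr => i _; rewrite mul1r.
  rewrite card_dffun_ord ln_prod_expn// lee_fin lnm !mulr_sumr -big_split /=.
  by apply: ler_sum => i _; rewrite natrD natrM mulrDl mulrA (mulrC n%:R).
(* Radius r m covers the coordinates from which the first j_i n ones can be recovered, for all [i]
   at once. *)
exists [set cylinder x (r * m) | x in setT]; first exact: open_cover_cylinders.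
move=> n n0.
pose D := {dffun forall i, {ffun 'I_(j i * n) -> 'I_(q i)}}.
have card_gt0 : (0 < #|D|)%N.
  by rewrite card_dffun_ord; apply: prodn_gt0 => i; rewrite expn_gt0 q_gt0.
(* Words for different factors have different lengths; each is padded with the digit 0. *)
pose digit (c : D) b i := oapp (fun b => c i b : nat) 0%N (insub b).
(* [m %/ q l] is divisible by every [q i] but [q l], to which it is coprime, so
   modulo [q i] the value of [s c] at [b] determines the digit [c i b]. *)
pose s (c : D) : configuration m := fun a =>
  if a is Posz b then \sum_i (digit c b i)%:R * (m %/ q i)%:R else 0.
apply: le_trans (cover_entropy_ge (s := s) _ card_gt0 _); last first.
  move=> _ [A AU <-] c c' cA c'A; apply/ffunP => i; apply/ffunP => b.
  (* Two points in one cell of the join have a difference whose orbit vanishes on [0, r m[ before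
     time [n]. *)
  pose z (a : int) : 'Z_m := s c a - s c' a.
  have zT t (a : nat) : (t < n)%N -> (a < r * m)%N -> (q i %| iter t T z a%:Z)%N.
    move=> tn arm.
    have [x _ Ax] := AU t; move: (cA t tn) (c'A t tn); rewrite /= -Ax => cx c'x.
    have -> : iter t T z a%:Z = 0.
      transitivity (iter t T (s c) a%:Z - iter t T (s c') a%:Z : 'Z_m).
        exact: iter_shift_actB.
      by rewrite (cx a%:Z (ltnW arm)) (c'x a%:Z (ltnW arm)) subrr.
    by rewrite (val_Zp_nat hm 0) mod0n dvdn0.
  have zE : z (b : nat)%:Z = \sum_l ((digit c b l)%:R * (m %/ q l)%:R -
      (digit c' b l)%:R * (m %/ q l)%:R) by rewrite sumrB.
  have := dvdn_of_iter_rule hm (p_prime i) (k_gt0 i) (qm i) hr (@FG i) (j_range i)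
    (alpha_j_coprime' i) zT (ltn_ord b).
  rewrite zE (bigD1 i)// -mulrBl => /(dvdn_ZpP _ hm (qm i))[y yE].
  have [w wE] : exists w, \sum_(l | l != i) ((digit c b l)%:R * (m %/ q l)%:R -
      (digit c' b l)%:R * (m %/ q l)%:R) = (q i)%:R * w :> 'Z_m.
    apply: (big_ind (fun v : 'Z_m => exists w, v = (q i)%:R * w)) => [|u v [w ->] [w' ->]|l li].
    - by exists 0; rewrite mulr0.
    - by exists (w + w'); rewrite mulrDr.
    have /dvdnP[w wE] : (q i %| m %/ q l)%N.
      by rewrite -(Gauss_dvdr _ (q_coprime _ _ (_ : i != l))) 1?eq_sym// mulnC divnK.
    by exists ((digit c b l)%:R * w%:R - (digit c' b l)%:R * w%:R); rewrite wE natrM; ring.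
  have : (q i %| ((m %/ q i)%:R * ((digit c b i)%:R - (digit c' b i)%:R) : 'Z_m)%R)%N.
    by apply/dvdn_ZpP => //; exists (y - w); rewrite [RHS]mulrBr -yE wE addrK mulrC.
  (* Here m / q_i can be cancelled: in Z_m it is the coefficient of index j_i, assumed prime to
     p_i. *)
  rewrite Zp_Gauss_dvdr//; last by rewrite coprime_sym coprimeXr// -alpha_j.
  rewrite dvdn_Zp_sub// !val_Zp_nat// !modn_dvdm// /digit !valK /=.
  by rewrite !modn_small// => /eqP/val_inj.
rewrite card_dffun_ord ln_prod_expn// lee_fin mulr_sumr.
by apply: ler_sum => i _; rewrite mulrA -natrM mulnC.
Qed.
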